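(* Let $\mathcal{F}$ be the total primitive term specification for $\mathsf{QLP}^-$. If $A$ is an axiom instance of $\mathsf{QLP}^-$ and $x$ is a justification variable not occurring free in $A$, then $\mathsf{QLP}^-_{\mathcal{F}}\vdash(\exists x)x:A$; i.e. the rule ''from an axiom instance $A$ infer $(\exists x)x:A$ (with $x$ not free in $A$)'' is admissible in $\mathsf{QLP}^-_{\mathcal{F}}$.
   Context: Fix countably many justification variables, propositional variables, and primitive function symbols of each arity $n\ge0$ (arity $0$: constants). A primitive term is $f(x_1,\dots,x_n)$ with $f$ of arity $n$ and $x_i$ variables. Terms of $\mathsf{QLP}^-$: $t::= x\mid f(x_1,\dots,x_n)\mid t\cdot t\mid t+t\mid !t$. Formulas: $A::= p\mid\bot\mid\neg A\mid A\wedge A\mid A\vee A\mid A\rightarrow A\mid t:A\mid(\forall x)A\mid(\exists x)A$, with $x$ a justification variable; free/bound variables and substitution as in first-order logic. Axioms: all propositional tautologies; Q1: $(\forall x)A(x)\rightarrow A(t)$, $t$ free for $x$; Q2: $(\forall x)(A\rightarrow B(x))\rightarrow(A\rightarrow(\forall x)B(x))$, $x$ not free in $A$; Q3: $A(t)\rightarrow(\exists x)A(x)$, $t$ free for $x$; Q4: $(\forall x)(A(x)\rightarrow B)\rightarrow((\exists x)A(x)\rightarrow B)$, $x$ not free in $B$; jK: $s:(A\rightarrow B)\rightarrow(t:A\rightarrow(s\cdot t):B)$; jT: $t:A\rightarrow A$; j4: $t:A\rightarrow !t:t:A$; Sum: $s:A\rightarrow(s+t):A$, $s:A\rightarrow(t+s):A$.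 Rules: Modus Ponens; Gen: from $A$ infer $(\forall x)A$; Axiom Necessitation (AN): from an axiom instance $A$ infer $f(x_1,\dots,x_n):A$ for a primitive term. The total primitive term specification is the set of all $f(x_1,\dots,x_n):A$ with $A$ an axiom instance and $f(x_1,\dots,x_n)$ a primitive term; for a primitive term specification $\mathcal{F}$ (a subset of it), $\mathsf{QLP}^-_{\mathcal{F}}$ is the logic in which AN only produces members of $\mathcal{F}$. *)

(* Defs.v *)
From mathcomp Require Import all_boot.

Set Implicit Arguments.
Unset Strict Implicit.
Unset Printing Implicit Defensive.

Definition jvar := nat.
Definition pvar := nat.

(* Function symbols of arity n are indexed by nat: [Prim n f xs] applies the
   f-th symbol of arity n. As in the grammar of QLP^-, the arguments of a
   function symbol are variables, not arbitrary terms. *)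
Inductive term : Type :=
| Var of jvar
| Prim (n : nat) (f : nat) (xs : n.-tuple jvar)
| App of term & term
| Sum of term & term
| Bang of term.

Inductive form : Type :=
| PVar of pvar
| Bot
| Neg of form
| And of form & form
| Or of form & form
| Imp of form & form
| Just of term & form
| All of jvar & form
| Ex of jvar & form.

Fixpoint occurs (x : jvar) (t : term) : bool :=
  match t with
  | Var y => x == y
  | Prim _ _ ys => x \in (ys : seq nat)
  | App s1 s2 | Sum s1 s2 => occurs x s1 || occurs x s2
  | Bang s => occurs x s
  end.

Fixpoint free (x : jvar) (A : form) : bool :=
  match A with
  | PVar _ | Bot => false
  | Neg B => free x B
  | And B C | Or B C | Imp B C => free x B || free x C
  | Just s B => occurs x s || free x B
  | All y B | Ex y B => (x != y) && free x B
  end.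

Definition omap2 (T1 T2 T : Type) (g : T1 -> T2 -> T)
    (u : option T1) (v : option T2) : option T :=
  if u is Some a then omap (g a) v else None.

(* Substitution of t for x. Since function symbols only take variables as
   arguments, f(..., x, ...) has a substitution instance in the language only
   when t is a variable; otherwise the result is [None]. *)
Fixpoint tsubst (x : jvar) (t s : term) : option term :=
  match s with
  | Var y => Some (if y == x then t else s)
  | Prim n f ys =>
      if x \notin (ys : seq nat) then Some s
      else if t is Var z then
        Some (Prim f [tuple of [seq (if y == x then z else y) | y <- ys]])
      else None
  | App s1 s2 => omap2 App (tsubst x t s1) (tsubst x t s2)
  | Sum s1 s2 => omap2 Sum (tsubst x t s1) (tsubst x t s2)
  | Bang s1 => omap Bang (tsubst x t s1)
  end.

(* Replaces the free occurrences of x by t without renaming bound variables;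
   capture is excluded separately, by [free_for]. *)
Fixpoint subst (x : jvar) (t : term) (A : form) : option form :=
  match A with
  | PVar _ | Bot => Some A
  | Neg B => omap Neg (subst x t B)
  | And B C => omap2 And (subst x t B) (subst x t C)
  | Or B C => omap2 Or (subst x t B) (subst x t C)
  | Imp B C => omap2 Imp (subst x t B) (subst x t C)
  | Just s B => omap2 Just (tsubst x t s) (subst x t B)
  | All y B => if y == x then Some A else omap (All y) (subst x t B)
  | Ex y B => if y == x then Some A else omap (Ex y) (subst x t B)
  end.

Fixpoint free_for (t : term) (x : jvar) (A : form) : bool :=
  match A with
  | PVar _ | Bot => true
  | Neg B | Just _ B => free_for t x B
  | And B C | Or B C | Imp B C => free_for t x B && free_for t x C
  | All y B | Ex y B =>
      (y == x) || ((free x B ==> ~~ occurs y t) && free_for t x B)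
  end.

(* Formulas t:A, (forall x)A and (exists x)A count as propositional atoms, so
   that [tautology] covers all instances of tautologies in the language. *)
Fixpoint peval (v : form -> bool) (A : form) : bool :=
  match A with
  | PVar _ | Just _ _ | All _ _ | Ex _ _ => v A
  | Bot => false
  | Neg B => ~~ peval v B
  | And B C => peval v B && peval v C
  | Or B C => peval v B || peval v C
  | Imp B C => peval v B ==> peval v C
  end.

Definition tautology (A : form) : Prop := forall v, peval v A.

Inductive axiom : form -> Prop :=
| ax_taut A : tautology A -> axiom A
| ax_Q1 x t A B : free_for t x A -> subst x t A = Some B ->
    axiom (Imp (All x A) B)
| ax_Q2 x A B : ~~ free x A ->
    axiom (Imp (All x (Imp A B)) (Imp A (All x B)))
| ax_Q3 x t A B : free_for t x A -> subst x t A = Some B ->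
    axiom (Imp B (Ex x A))
| ax_Q4 x A B : ~~ free x B ->
    axiom (Imp (All x (Imp A B)) (Imp (Ex x A) B))
| ax_jK s t A B :
    axiom (Imp (Just s (Imp A B)) (Imp (Just t A) (Just (App s t) B)))
| ax_jT t A : axiom (Imp (Just t A) A)
| ax_j4 t A : axiom (Imp (Just t A) (Just (Bang t) (Just t A)))
| ax_Suml s t A : axiom (Imp (Just s A) (Just (Sum s t) A))
| ax_Sumr s t A : axiom (Imp (Just s A) (Just (Sum t s) A)).

Definition total_spec (C : form) : Prop :=
  exists (n f : nat) (xs : n.-tuple jvar) (A : form),
    axiom A /\ C = Just (Prim f xs) A.

(* Only the members of F lying in [total_spec] are ever used. *)
Inductive provable (F : form -> Prop) : form -> Prop :=
| pr_ax A : axiom A -> provable F A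
| pr_MP A B : provable F (Imp A B) -> provable F A -> provable F B
| pr_Gen x A : provable F A -> provable F (All x A)
| pr_AN n f (xs : n.-tuple jvar) A :
    axiom A -> F (Just (Prim f xs) A) -> provable F (Just (Prim f xs) A).

(* Main.v *)
(* The witness is a constant c: axiom necessitation gives c : A, which is the
   instance of x : A at x := c because x is not free in A, and c is free for x
   because no variable occurs in it; Q3 concludes. *)
Require Import Defs.
From mathcomp Require Import all_boot.

(** No failure arises at a function symbol: [tsubst] tests for [x] among the arguments before asking
    that [t] be a variable. *)
Lemma tsubst_not_occurs (x : jvar) (t s : term) :
  ~~ occurs x s -> tsubst x t s = Some s.
Proof.
elim: s => [y|n f ys|s1 IH1 s2 IH2|s1 IH1 s2 IH2|s IH] /=.
- by rewrite eq_sym => /negbTE ->.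
- by move=> ->.
- by rewrite negb_or => /andP[/IH1 -> /IH2 ->].
- by rewrite negb_or => /andP[/IH1 -> /IH2 ->].
- by move=> /IH ->.
Qed.

Lemma subst_not_free (x : jvar) (t : term) (A : form) :
  ~~ free x A -> subst x t A = Some A.
Proof.
elim: A => [p||B IH|B IHB C IHC|B IHB C IHC|B IHB C IHC|s B IH|y B IH|y B IH] //=;
  rewrite ?negb_or ?negb_and ?negbK.
- by move=> /IH ->.
- by case/andP=> /IHB -> /IHC ->.
- by case/andP=> /IHB -> /IHC ->.
- by case/andP=> /IHB -> /IHC ->.
- by case/andP=> /(tsubst_not_occurs x t) -> /IH ->.
- by rewrite (eq_sym y); case: eqP => //= _ /IH ->.
- by rewrite (eq_sym y); case: eqP => //= _ /IH ->.
Qed.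

(** With no variable in [t], no quantifier can capture anything. *)
Lemma free_for_closed (t : term) (x : jvar) (A : form) :
  (forall y, ~~ occurs y t) -> free_for t x A.
Proof.
move=> closed_t.
elim: A => //= [B -> C ->|B -> C ->|B -> C ->|y B ->|y B ->] //;
  by rewrite closed_t implybT orbT.
Qed.

Theorem theorem21 (A : form) (x : jvar) (hA : axiom A) (hx : ~~ free x A) :
  provable total_spec (Ex x (Just (Var x) A)).
Proof.
(* Here [0] is the symbol's index; the empty tuple makes the arity zero. Any constant would do,
   since [total_spec] lets each one justify every axiom. *)
pose c := Prim 0 [tuple].
apply: (@pr_MP _ (Just c A)).
  apply/pr_ax/(@ax_Q3 x c); first exact: free_for_closed.
  by rewrite /= eqxx subst_not_free.
by apply: pr_AN => //; exists 0, 0, [tuple], A.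
Qed.
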